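(* Let $\mathcal L$ be a team-based propositional logic whose atoms are polynomial-time checkable (for every $\mathcal L$-atom $\alpha$ and every team $T$, whether $T\models\alpha$ can be decided in time polynomial in the sizes of $\alpha$ and $T$). Then the model checking problem for $\mathcal L$ (under lax semantics, and also under strict semantics), parameterised by $\mathrm{teamsize}$, is in $\mathrm{FPT}$.
   Context: Team semantics. Fix a countably infinite set of propositional variables. An assignment is a map from variables to $\{0,1\}$; a team is a finite set of assignments over a common finite set of variables. For a tuple $\mathbf x=(x_1,\dots,x_n)$ and assignment $s$, $s(\mathbf x)=(s(x_1),\dots,s(x_n))$. A team-based propositional logic $\mathcal L$ has formulas built by $\varphi ::= \top\mid\bot\mid x\mid\neg x\mid \alpha\mid\varphi\land\varphi\mid\varphi\lor\varphi$, where $\alpha$ ranges over the logic's atoms (e.g. dependence atoms $=\!(\mathbf x,\mathbf y)$, inclusion atoms $\mathbf x\subseteq\mathbf y$, independence atoms $\mathbf x\perp_{\mathbf z}\mathbf y$), and whose semantics is: $T\models\top$ always; $T\models\bot$ iff $T=\emptyset$; $T\models x$ iff $t(x)=1$ for all $t\in T$; $T\models\neg x$ iff $t(x)=0$ for all $t\in T$; $T\models\varphi\land\psi$ iff $T\models\varphi$ and $T\models\psi$; under lax semantics $T\models\varphi\lor\psi$ iff there are $T_1,T_2$ with $T_1\cup T_2=T$, $T_1\models\varphi$, $T_2\models\psi$; under strict semantics additionally $T_1\cap T_2=\emptyset$ is required; the atoms have their own team semantics. Model checking problem: given a team $T$ and a formula $\varphi$, decide whether $T\models\varphi$. The parameter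 $\mathrm{teamsize}$ of an instance is $|T|$. Parameterised complexity: a parameterised problem consists of pairs $(x,k)$ with $k\in\mathbb N$; it is in $\mathrm{FPT}$ if it is decidable by a deterministic algorithm in time $f(k)\cdot p(|x|)$ for a computable $f$ and polynomial $p$. *)

(* Defs.v *)
From mathcomp Require Import all_boot all_algebra finmap.

Set Implicit Arguments.
Unset Strict Implicit.
Unset Printing Implicit Defensive.

Local Open Scope fset_scope.
Local Open Scope fmap_scope.

(* The model of computation is the WHILE language over binary trees (N. Jones,
   "Computability and Complexity from a Programming Perspective"), charged one
   time unit per elementary operation.  With trees stored as shared cells each
   operation is O(1) pointer work and allocates at most one cell, so the model
   and Turing machines simulate each other with polynomial overhead. *)

Inductive tree : Type := Leaf | Node of tree & tree.

Fixpoint tsize (w : tree) : nat :=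
  if w is Node u v then (tsize u + tsize v).+1 else 1.

Definition thd (w : tree) : tree := if w is Node u _ then u else Leaf.
Definition ttl (w : tree) : tree := if w is Node _ v then v else Leaf.

Inductive expr : Type :=
| EVar of nat
| ENil
| ECons of expr & expr
| EHd of expr
| ETl of expr.

Inductive cmd : Type :=
| Assign of nat & expr
| Seq of cmd & cmd
| If of expr & cmd & cmd
| While of expr & cmd.

Definition store := nat -> tree.

Definition update (s : store) (i : nat) (w : tree) : store :=
  fun j => if j == i then w else s j.

Fixpoint eval (s : store) (e : expr) : tree :=
  match e with
  | EVar i => s i
  | ENil => Leaf
  | ECons e1 e2 => Node (eval s e1) (eval s e2)
  | EHd e1 => thd (eval s e1)
  | ETl e1 => ttl (eval s e1)
  end.

Fixpoint ecost (e : expr) : nat :=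
  match e with
  | EVar _ | ENil => 1
  | ECons e1 e2 => (ecost e1 + ecost e2).+1
  | EHd e1 | ETl e1 => (ecost e1).+1
  end.

(* [exec c s s' t]: started in store [s], [c] halts in store [s'] after exactly
   [t] time units.  A test succeeds when the value is not [Leaf]. *)
Inductive exec : cmd -> store -> store -> nat -> Prop :=
| ExecAssign i e s :
    exec (Assign i e) s (update s i (eval s e)) (ecost e).+1
| ExecSeq c1 c2 s s1 s2 t1 t2 :
    exec c1 s s1 t1 -> exec c2 s1 s2 t2 ->
    exec (Seq c1 c2) s s2 (t1 + t2)
| ExecIfT e c1 c2 s s1 t :
    eval s e <> Leaf -> exec c1 s s1 t ->
    exec (If e c1 c2) s s1 (ecost e + t).+1
| ExecIfF e c1 c2 s s1 t :
    eval s e = Leaf -> exec c2 s s1 t ->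
    exec (If e c1 c2) s s1 (ecost e + t).+1
| ExecWhileT e c s s1 s2 t1 t2 :
    eval s e <> Leaf -> exec c s s1 t1 -> exec (While e c) s1 s2 t2 ->
    exec (While e c) s s2 (ecost e + t1 + t2).+1
| ExecWhileF e c s :
    eval s e = Leaf -> exec (While e c) s s (ecost e).+1.

Lemma exec_det c s s1 s2 t1 t2 :
  exec c s s1 t1 -> exec c s s2 t2 -> s1 = s2 /\ t1 = t2.
Proof.
move=> H; elim: H s2 t2 => {c s s1 t1}
  [i e s|c1 c2 s s1 s' t1 t2 _ IH1 _ IH2|e c1 c2 s s1 t eT _ IH
  |e c1 c2 s s1 t eF _ IH|e c s s1 s' t1 t2 eT _ IH1 _ IH2|e c s eF] s2 u H;
  inversion H; subst=> //.
- by edestruct IH1; [eassumption | subst]; edestruct IH2; [eassumption | subst].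
- by edestruct IH; [eassumption | subst].
- by edestruct IH; [eassumption | subst].
- by edestruct IH1; [eassumption | subst]; edestruct IH2; [eassumption | subst].
Qed.

(* Input and output are passed in variable 0. *)
Definition init (w : tree) : store := update (fun=> Leaf) 0 w.

(* [P] is the truth value of the queried property at the input [w];
   acceptance is a final value other than [Leaf]. *)
Definition decides_within (c : cmd) (w : tree) (P : Prop) (bound : nat) : Prop :=
  exists s t, [/\ exec c (init w) s t, t <= bound & s 0 <> Leaf <-> P].

Fixpoint code_seq (A : Type) (code : A -> tree) (l : seq A) : tree :=
  if l is a :: l' then Node (code a) (code_seq code l') else Leaf.

Definition code_nat (n : nat) : tree := code_seq id (nseq n Leaf).

Definition code_bool (b : bool) : tree := if b then Node Leaf Leaf else Leaf.

Definition computable (f : nat -> nat) : Prop :=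
  exists c, forall n, exists s t,
    exec c (init (code_nat n)) s t /\ s 0 = code_nat (f n).

(* [is_instance x k] singles out the pairs where [x] is the code of an instance
   and [k] its parameter; [is_yes x k] the positive ones among them.
   As for the atoms below, algorithms are run on codes of instances only. *)
Record parameterised_problem : Type := ParameterisedProblem {
  is_instance : tree -> nat -> Prop;
  is_yes : tree -> nat -> Prop }.

Definition in_FPT (Q : parameterised_problem) : Prop :=
  exists (c : cmd) (f : nat -> nat) (p : {poly nat}),
    computable f /\
    forall x k, is_instance Q x k ->
      decides_within c (Node x (code_nat k)) (is_yes Q x k)
        (f k * horner p (tsize x)).

(* The variables are the binary words, so a variable has a code of size linear
   in the length of its name. *)
Definition var : Type := seq bool.

Definition assignment : Type := {fmap var -> bool}.

Definition team : Type := {fset assignment}.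

Definition team_over (X : {fset var}) (T : team) : Prop :=
  forall s : assignment, s \in T -> domf s = X.

(* Satisfaction is only meaningful for teams over a set of variables that
   contains the variables of the atom. *)
Record logic : Type := Logic {
  atom : Type;
  atom_vars : atom -> {fset var};
  atom_sat : team -> atom -> Prop;
  atom_code : atom -> tree;
  atom_code_inj : injective atom_code }.

Inductive formula (L : logic) : Type :=
| FTop
| FBot
| FPos of var
| FNeg of var
| FAtom of atom L
| FAnd of formula L & formula L
| FOr of formula L & formula L.

Fixpoint formula_vars (L : logic) (phi : formula L) : {fset var} :=
  match phi with
  | FTop | FBot => fset0
  | FPos x | FNeg x => [fset x]
  | FAtom a => atom_vars a
  | FAnd phi1 phi2 | FOr phi1 phi2 => formula_vars phi1 `|` formula_vars phi2
  end.

Variant semantics : Type := Lax | Strict.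

Fixpoint sat (L : logic) (m : semantics) (T : team) (phi : formula L) : Prop :=
  match phi with
  | FTop => True
  | FBot => T = fset0
  | FPos x => forall t : assignment, t \in T -> t.[? x] = Some true
  | FNeg x => forall t : assignment, t \in T -> t.[? x] = Some false
  | FAtom a => atom_sat T a
  | FAnd phi1 phi2 => sat m T phi1 /\ sat m T phi2
  | FOr phi1 phi2 =>
      exists T1 T2 : team,
        [/\ T1 `|` T2 = T, m = Strict -> T1 `&` T2 = fset0,
            sat m T1 phi1 & sat m T2 phi2]
  end.

Definition code_var : var -> tree := code_seq code_bool.

Fixpoint code_formula (L : logic) (phi : formula L) : tree :=
  match phi with
  | FTop => Node (code_nat 0) Leaf
  | FBot => Node (code_nat 1) Leaf
  | FPos x => Node (code_nat 2) (code_var x)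
  | FNeg x => Node (code_nat 3) (code_var x)
  | FAtom a => Node (code_nat 4) (atom_code a)
  | FAnd phi1 phi2 =>
      Node (code_nat 5) (Node (code_formula phi1) (code_formula phi2))
  | FOr phi1 phi2 =>
      Node (code_nat 6) (Node (code_formula phi1) (code_formula phi2))
  end.

(* Assignments and teams are sets, so their codes are relations: a code lists
   the elements without repetition, in an arbitrary order. *)
Definition codes_assignment (w : tree) (s : assignment) : Prop :=
  exists l : seq (var * bool),
    [/\ uniq l, forall x b, (x, b) \in l <-> s.[? x] = Some b &
        w = code_seq (fun xb => Node (code_var xb.1) (code_bool xb.2)) l].

Inductive codes_list (A : Type) (codes : tree -> A -> Prop) :
    tree -> seq A -> Prop :=
| CodesNil : codes_list codes Leaf [::]
| CodesCons w a v l :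
    codes w a -> codes_list codes v l -> codes_list codes (Node w v) (a :: l).

Definition codes_team (w : tree) (T : team) : Prop :=
  exists l : seq assignment,
    [/\ uniq l, l =i T & codes_list codes_assignment w l].

Definition poly_checkable (L : logic) : Prop :=
  exists (c : cmd) (p : {poly nat}),
    forall (X : {fset var}) (T : team) (a : atom L) (w : tree),
      team_over X T -> atom_vars a `<=` X -> codes_team w T ->
      decides_within c (Node w (atom_code a)) (atom_sat T a)
        (horner p (tsize w + tsize (atom_code a))).

Definition mc_instance (L : logic) (x : tree) (T : team) (phi : formula L) :
    Prop :=
  exists (X : {fset var}) (w : tree),
    [/\ team_over X T, formula_vars phi `<=` X, codes_team w T &
        x = Node w (code_formula phi)].

Definition teamsize (T : team) : nat := #|` T|.

Definition model_checking (L : logic) (m : semantics) : parameterised_problem :=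
  {| is_instance := fun x k => exists (T : team) (phi : formula L),
       mc_instance x T phi /\ k = teamsize T;
     is_yes := fun x k => exists (T : team) (phi : formula L),
       [/\ mc_instance x T phi, k = teamsize T & sat m T phi] |}.

(* Main.v *)
From HB Require Import structures.
From mathcomp Require Import all_boot all_algebra finmap zify.
Require Import Defs.

(* Bottom-up dynamic programming over the formula.  For a team with k elements,
   compute for every subformula the set of all satisfying subteams, as a table
   with 2^k entries.  Literals and atoms are checked on every subteam; an entry
   of a compound formula is found by trying the at most 3^k ways to split the
   subteam and looking up both parts in the tables of the subformulas.  This
   costs 8^k times a polynomial.  The recursion is run by a stack machine, i.e.
   a single WHILE loop whose body is loop-free up to the call of the atom
   checker, so that running time is the number of iterations times a uniform
   bound on one iteration. *)

Set Implicit Arguments.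
Unset Strict Implicit.
Unset Printing Implicit Defensive.

Local Open Scope nat_scope.

(** * Polynomial bounds *)

(** Tables are needed because a direct recursion over splits would multiply the number of splits at
    every nested disjunction, and the exponent would depend on the formula. The atom checker is an
    arbitrary program, known to be correct and fast only when started in [init w] on the code of a
    genuine team. Hence the machine state sits in one variable above all those of the checker, and
    these are wiped before each call. Subteams are handed over as sublists of the given team code: a
    code may list a team in any order, so the reversed accumulator built while choosing members is
    itself a valid code, no larger than the input. Truth means being different from [Leaf]
    throughout, so raw checker outputs can serve as table entries. The base 8 is 2 for the entries
    times 4 for one search; 4 instead of 3 absorbs the inner nodes of the ternary search tree. *)

Lemma horner_nat_mono (p : {poly nat}) (m n : nat) :
  m <= n -> horner p m <= horner p n.
Proof.
rewrite /horner => le_mn; elim: (polyseq p) => //= a s IH.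
by apply: leq_add => //; apply: leq_mul.
Qed.

Definition polynomial_fun (F : nat -> nat) : Prop :=
  exists q : {poly nat}, forall n, horner q n = F n.

Lemma polynomial_horner (p : {poly nat}) : polynomial_fun (horner p).
Proof. by exists p. Qed.

Lemma polynomial_const a : polynomial_fun (fun=> a).
Proof. by exists (polyC a) => n; rewrite hornerC. Qed.

Lemma polynomial_id : polynomial_fun id.
Proof. by exists (polyX _) => n; rewrite hornerX. Qed.

Lemma polynomial_add F G : polynomial_fun F -> polynomial_fun G ->
  polynomial_fun (fun n => F n + G n).
Proof. by move=> [p pF] [q qG]; exists (p + q)%R => n; rewrite hornerD pF qG. Qed.

Lemma polynomial_mul F G : polynomial_fun F -> polynomial_fun G ->
  polynomial_fun (fun n => F n * G n).
Proof. by move=> [p pF] [q qG]; exists (p * q)%R => n; rewrite hornerM pF qG. Qed.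

(** * Computability of exponentials *)

Definition push7 (e : expr) : expr := iter 7 (ECons ENil) e.

(** Each round multiplies variable 1 by 8: a copy of its value r counts r passes, each adding 7, and
    r + 7r = 8r. *)
Definition pow8_cmd : cmd :=
  Seq (Assign 1 (ECons ENil ENil))
  (Seq (While (EVar 0)
         (Seq (Assign 0 (ETl (EVar 0)))
         (Seq (Assign 2 (EVar 1))
              (While (EVar 2)
                 (Seq (Assign 2 (ETl (EVar 2)))
                      (Assign 1 (push7 (EVar 1))))))))
       (Assign 0 (EVar 1))).

Lemma exec_push_loop n r s : s 2 = code_nat n -> s 1 = code_nat r ->
  exists s' t, [/\ exec (While (EVar 2) (Seq (Assign 2 (ETl (EVar 2)))
                      (Assign 1 (push7 (EVar 1))))) s s' t,
     s' 1 = code_nat (r + 7 * n) & s' 0 = s 0].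
Proof.
elim: n r s => [|n IH] r s s2 s1.
  exists s; eexists; split; first by apply: ExecWhileF; rewrite /= s2.
    by rewrite muln0 addn0.
  by [].
set s' := update (update s 2 (code_nat n)) 1 (code_nat (7 + r)).
have [//|//|s'' [t [H1 H2 H3]]] := IH (7 + r) s'.
exists s''; eexists; split; last by rewrite H3.
  apply: ExecWhileT; [by rewrite /= s2| |exact: H1].
  have -> : s' = update (update s 2 (eval s (ETl (EVar 2)))) 1
             (eval (update s 2 (eval s (ETl (EVar 2)))) (push7 (EVar 1))).
    by rewrite /s' /= s2 /update /= s1.
  by apply: ExecSeq; apply: ExecAssign.
by rewrite H2; congr code_nat; lia.
Qed.

Lemma computable_pow8 : computable (fun n => 8 ^ n).
Proof.
exists pow8_cmd => n.
suff loop m r s : s 0 = code_nat m -> s 1 = code_nat r ->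
  exists s' t, exec (While (EVar 0)
         (Seq (Assign 0 (ETl (EVar 0)))
         (Seq (Assign 2 (EVar 1))
              (While (EVar 2)
                 (Seq (Assign 2 (ETl (EVar 2)))
                      (Assign 1 (push7 (EVar 1)))))))) s s' t
      /\ s' 1 = code_nat (r * 8 ^ m).
  have [//|//|s' [t [H1 H2]]] :=
    loop n 1 (update (init (code_nat n)) 1 (code_nat 1)).
  exists (update s' 0 (s' 1)); eexists; split; last by rewrite /update H2 mul1n.
  apply: ExecSeq; first exact: ExecAssign.
  by apply: ExecSeq; [exact: H1 | exact: (ExecAssign 0 (EVar 1))].
elim: m r s => [|m IH] r s s0 s1.
  exists s; eexists; split; first by apply: ExecWhileF; rewrite /= s0.
  by rewrite muln1.
set u := update (update s 0 (code_nat m)) 2 (code_nat r).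
have [//|//|u' [tu [U1 U2 U3]]] := @exec_push_loop r r u.
have [//|//|s' [t [H1 H2]]] := IH (r + 7 * r) u'.
exists s'; eexists; split; last by rewrite H2 expnS; congr code_nat; lia.
apply: ExecWhileT; [by rewrite /= s0| |exact: H1].
apply: ExecSeq; first exact: ExecAssign.
apply: ExecSeq; first exact: ExecAssign.
suff -> : update (update s 0 (eval s (ETl (EVar 0)))) 2
  (eval (update s 0 (eval s (ETl (EVar 0)))) (EVar 1)) = u by exact: U1.
by rewrite /u /= s0 /update /= s1.
Qed.

(** * Calling a program as a subroutine *)

Fixpoint expr_vars (e : expr) : nat :=
  match e with
  | EVar i => i.+1
  | ENil => 0
  | ECons e1 e2 => maxn (expr_vars e1) (expr_vars e2)
  | EHd e1 | ETl e1 => expr_vars e1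
  end.

Fixpoint cmd_vars (c : cmd) : nat :=
  match c with
  | Assign i e => maxn i.+1 (expr_vars e)
  | Seq c1 c2 => maxn (cmd_vars c1) (cmd_vars c2)
  | If e c1 c2 => maxn (expr_vars e) (maxn (cmd_vars c1) (cmd_vars c2))
  | While e c1 => maxn (expr_vars e) (cmd_vars c1)
  end.

Lemma eval_agree N e s r : expr_vars e <= N -> (forall i, i < N -> r i = s i) ->
  eval r e = eval s e.
Proof.
move=> + rs; elim: e => [i||e1 IH1 e2 IH2|e IH|e IH] //=; first exact: rs.
- by rewrite geq_max => /andP[/IH1-> /IH2->].
- by move/IH->.
- by move/IH->.
Qed.

(** A program neither reads nor writes variables from [cmd_vars c] on, so its run can be replayed in
    any store that agrees below. This transfers the checker's run from [init w] to a store that also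
    holds the machine state. *)
Lemma exec_frame N c s s' t : exec c s s' t -> cmd_vars c <= N ->
  forall r, (forall i, i < N -> r i = s i) ->
  exists2 r', exec c r r' t & forall i, r' i = if i < N then s' i else r i.
Proof.
elim=> {c s s' t}
  [i e s|c1 c2 s s1 s2 t1 t2 _ IH1 _ IH2|e c1 c2 s s1 t eT _ IH
  |e c1 c2 s s1 t eF _ IH|e c s s1 s2 t1 t2 eT _ IH1 _ IH2|e c s eF] /=;
  rewrite ?geq_max.
- move=> /andP[iN eN] r rs; exists (update r i (eval r e)).
    exact: ExecAssign.
  move=> j; rewrite /update; case: eqP => [->|_].
    by rewrite iN (eval_agree eN rs).
  by case: ifP => // /rs.
- move=> /andP[N1 N2] r rs; have [r1 E1 r1P] := IH1 N1 r rs.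
  have [i iN|r2 E2 r2P] := IH2 N2 r1; first by rewrite r1P iN.
  exists r2; first exact: ExecSeq E1 E2.
  by move=> i; rewrite r2P; case: ifP => // iN; rewrite r1P iN.
- move=> /and3P[eN N1 _] r rs; have [r1 E1 r1P] := IH N1 r rs.
  by exists r1 => //; apply: ExecIfT => //; rewrite (eval_agree eN rs).
- move=> /and3P[eN _ N1] r rs; have [r1 E1 r1P] := IH N1 r rs.
  by exists r1 => //; apply: ExecIfF => //; rewrite (eval_agree eN rs).
- move=> /andP[eN N1] r rs; have [r1 E1 r1P] := IH1 N1 r rs.
  have wN : cmd_vars (While e c) <= N by rewrite geq_max eN.
  have [i iN|r2 E2 r2P] := IH2 wN r1; first by rewrite r1P iN.
  exists r2; first by apply: ExecWhileT E1 E2; rewrite (eval_agree eN rs).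
  by move=> i; rewrite r2P; case: ifP => // iN; rewrite r1P iN.
- move=> /andP[eN _] r rs; exists r.
    by apply: ExecWhileF; rewrite (eval_agree eN rs).
  by move=> i; case: ifP => // /rs.
Qed.

(** Erases what earlier calls of the checker left behind. For want of a skip command the base case
    resets variable 0, which is harmless since 0 receives the query next. *)
Fixpoint clear_below (n : nat) : cmd :=
  if n is m.+1 then Seq (clear_below m) (Assign m ENil) else Assign 0 ENil.

Lemma exec_clear_below n s : exists2 s',
  exec (clear_below n) s s' (2 * n.+1) &
  forall i, s' i = if (i < n) || (i == 0) then Leaf else s i.
Proof.
elim: n => [|n [s' E H]] /=.
  by exists (update s 0 Leaf); [exact: (ExecAssign 0 ENil) | move=> i].
exists (update s' n Leaf).
  have -> : 2 * n.+2 = 2 * n.+1 + 2 by lia.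
  by apply: ExecSeq E _; exact: (ExecAssign n ENil).
move=> i; rewrite /update H; case: eqP => [->|/eqP ni]; first by rewrite ltnSn.
by congr (if _ || _ then _ else _); lia.
Qed.

(** * One-loop machines with an oracle *)

(* The only variable of the expressions below stands for the machine state
   [Node K (Node V W)]: a stack [K] of tasks, a stack [V] of values and a
   read-only register [W].  [Call e] asks the oracle about [e], pops the current
   task and pushes the answer on [V]. *)
Inductive prog : Type :=
| Ret of expr
| Call of expr
| Branch of expr & prog & prog.

Fixpoint at_var (N : nat) (e : expr) : expr :=
  match e with
  | EVar _ => EVar N
  | ENil => ENil
  | ECons e1 e2 => ECons (at_var N e1) (at_var N e2)
  | EHd e1 => EHd (at_var N e1)
  | ETl e1 => ETl (at_var N e1)
  end.

Definition at_state (st : tree) (e : expr) : tree := eval (fun=> st) e.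

Lemma eval_at_var N s e : eval s (at_var N e) = at_state (s N) e.
Proof.
by elim: e => //= [e1 -> e2 ->|e ->|e ->].
Qed.

Lemma ecost_at_var N e : ecost (at_var N e) = ecost e.
Proof. by elim: e => //= [e1 -> e2 ->|e ->|e ->]. Qed.

Definition state (K V W : tree) : tree := Node K (Node V W).

Definition resume (st v : tree) : tree :=
  state (ttl (thd st)) (Node v (thd (ttl st))) (ttl (ttl st)).

Definition resume_cmd (N : nat) : cmd :=
  Assign N (ECons (ETl (EHd (EVar N)))
              (ECons (ECons (EVar 0) (EHd (ETl (EVar N)))) (ETl (ETl (EVar N))))).

Fixpoint compile (N : nat) (c : cmd) (p : prog) : cmd :=
  match p with
  | Ret e => Assign N (at_var N e)
  | Call e => Seq (clear_below N)
                (Seq (Assign 0 (at_var N e)) (Seq c (resume_cmd N)))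
  | Branch e p1 p2 => If (at_var N e) (compile N c p1) (compile N c p2)
  end.

Fixpoint prun (p : prog) (st : tree) : bool * tree :=
  match p with
  | Ret e => (false, at_state st e)
  | Call e => (true, at_state st e)
  | Branch e p1 p2 => if at_state st e is Leaf then prun p2 st else prun p1 st
  end.

Fixpoint pcost (p : prog) : nat :=
  match p with
  | Ret e | Call e => (ecost e).+1
  | Branch e p1 p2 => (ecost e + maxn (pcost p1) (pcost p2)).+1
  end.

Definition answers (c : cmd) (b : nat) (w v : tree) : Prop :=
  exists s t, [/\ exec c (init w) s t, t <= b & s 0 = v].

Definition step (c : cmd) (b : nat) (p : prog) (st st' : tree) : Prop :=
  thd st <> Leaf /\
  match prun p st with
  | (false, st1) => st' = st1
  | (true, w) => exists2 v, answers c b w v & st' = resume st v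
  end.

(** The worst case is a call: [2 * N.+1] for clearing, [b] for the checker, 14 for the assignment
    [resume_cmd]. *)
Definition step_cost (N b : nat) (p : prog) : nat := pcost p + 2 * N.+1 + b + 14.

Lemma exec_compile N c b p s st' : 0 < N -> cmd_vars c <= N ->
  step c b p (s N) st' ->
  exists s' t, [/\ exec (compile N c p) s s' t, t <= step_cost N b p &
                   s' N = st'].
Proof.
move=> N0 cN [_]; rewrite /step_cost.
elim: p => [e|e|e p1 IH1 p2 IH2] /=.
- move=> ->; eexists; eexists; split; [exact: ExecAssign | |].
    by rewrite ecost_at_var; lia.
  by rewrite /update eqxx eval_at_var.
- move=> [v [s1 [t1 [E1 le_t1 s1v]]] ->].
  have [s2 E2 s2P] := exec_clear_below N s.
  have s2N : s2 N = s N by rewrite s2P ltnn /= (gtn_eqF N0).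
  have [i iN|s3 E3 s3P] := exec_frame E1 cN
    (r := update s2 0 (eval s2 (at_var N e))).
    rewrite /init /update; case: eqP => [_|_]; first by rewrite eval_at_var s2N.
    by rewrite s2P iN.
  have s3N : s3 N = s N.
    by rewrite s3P ltnn /update (gtn_eqF N0) s2N.
  have s30 : s3 0 = v by rewrite s3P N0.
  eexists; eexists; split.
  + apply: ExecSeq E2 _; apply: ExecSeq; first exact: ExecAssign.
    apply: ExecSeq E3 _; exact: ExecAssign.
  + by rewrite /= ecost_at_var; lia.
  + by rewrite /update eqxx /= s3N s30.
case E: (at_state (s N) e) => [|u v].
  move=> /IH2[s' [t [E2 le_t s'N]]].
  exists s'; eexists; split; [| |exact: s'N].
    by apply: ExecIfF; [rewrite eval_at_var | exact: E2].
  by rewrite ecost_at_var; lia.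
move=> /IH1[s' [t [E1 le_t s'N]]].
exists s'; eexists; split; [| |exact: s'N].
  by apply: ExecIfT; [rewrite eval_at_var E | exact: E1].
by rewrite ecost_at_var; lia.
Qed.

(** The number is only an upper bound on the steps: the reflexive case accepts any [n], so bounds
    can be weakened freely. *)
Inductive reach (c : cmd) (b : nat) (p : prog) : nat -> tree -> tree -> Prop :=
| ReachRefl n st : reach c b p n st st
| ReachStep n st st1 st2 :
    step c b p st st1 -> reach c b p n st1 st2 -> reach c b p n.+1 st st2.

Lemma reach_leq c b p n n' st st' :
  n <= n' -> reach c b p n st st' -> reach c b p n' st st'.
Proof.
move=> + R; elim: R n' => {n st st'} [n st|n st st1 st2 S _ IH] n' le_n.
  exact: ReachRefl.
by case: n' le_n => // n' le_n; apply: ReachStep S _; apply: IH.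
Qed.

Lemma reach_trans c b p n1 n2 st1 st2 st3 :
  reach c b p n1 st1 st2 -> reach c b p n2 st2 st3 ->
  reach c b p (n1 + n2) st1 st3.
Proof.
elim=> {n1 st1 st2} [n st|n st st1 st2 S _ IH] R.
  by apply: reach_leq R; rewrite leq_addl.
by rewrite addSn; apply: ReachStep S _; apply: IH.
Qed.

Lemma reach_ret c b p n st st1 st2 : thd st <> Leaf ->
  prun p st = (false, st1) -> reach c b p n st1 st2 -> reach c b p n.+1 st st2.
Proof. by move=> stK E; apply: ReachStep; split; rewrite ?E. Qed.

Lemma reach_call c b p n st w v st2 : thd st <> Leaf ->
  prun p st = (true, w) -> answers c b w v ->
  reach c b p n (resume st v) st2 -> reach c b p n.+1 st st2.
Proof. by move=> stK E A; apply: ReachStep; split; rewrite ?E //; exists v. Qed.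

Lemma exec_machine N c b p n s st' : 0 < N -> cmd_vars c <= N ->
  reach c b p n (s N) st' -> thd st' = Leaf ->
  exists s' t, [/\ exec (While (EHd (EVar N)) (compile N c p)) s s' t,
                   t <= n * (step_cost N b p + 3) + 3 & s' N = st'].
Proof.
move=> N0 cN; move: {2}(s N) (erefl (s N)) => st sN R st'K.
rewrite sN in R; elim: R s sN st'K => {n st st'} [n st|n st st1 st2 S _ IH] s sN K.
  exists s; eexists; split; [by apply: ExecWhileF; rewrite /= sN| |by []].
  by rewrite /=; lia.
rewrite -sN in S; have [s1 [t1 [E1 le_t1 s1N]]] := exec_compile N0 cN S.
have [s2 [t2 [E2 le_t2 s2N]]] := IH s1 s1N K.
exists s2; eexists; split; [| |exact: s2N].
  by apply: ExecWhileT E1 E2; case: S.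
by rewrite /=; move: le_t1 le_t2; set C := step_cost _ _ _; nia.
Qed.

(** * The model checking machine *)

(** Case distinction on a unary number: the program at position i runs for [code_nat i], and [q] for
    all larger numbers. *)
Fixpoint switch (e : expr) (ps : seq prog) (q : prog) : prog :=
  if ps is p :: ps' then Branch e (switch (ETl e) ps' q) p else q.

Definition enat (n : nat) : expr := iter n (ECons ENil) ENil.
Definition etrue : expr := ECons ENil ENil.

Definition eK : expr := EHd (EVar 0).
Definition eV : expr := EHd (ETl (EVar 0)).
Definition eW : expr := ETl (ETl (EVar 0)).
Definition etop : expr := EHd eK.
Definition erest : expr := ETl eK.
Definition earg : expr := ETl etop.

Definition task (n : nat) (w : tree) : tree := Node (code_nat n) w.
Definition etask (n : nat) (e : expr) : expr := ECons (enat n) e.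
Definition goto (K V : expr) : prog := Ret (ECons K (ECons V eW)).

(* Tables: the table of a formula for a team listed as [a_1, ..., a_k] is a
   binary tree of depth [k]; the path [b_1 ... b_k] leads to a leaf that is true
   iff the subteam [{a_i | b_i}] satisfies the formula.

   Tasks and their effect on the value stack:
     [eval_task phi]              pushes the table of [phi];
     [comb_task tag]              replaces the tables of [phi1] and [phi2] by that
                                  of the compound formula with code tag [tag];
     [gen_task l acc path info]   pushes a subtable: [l] is the rest of the team,
                                  [acc] the subteam chosen so far, [path] the
                                  reversed choices;
     [node_task]                  joins two subtables;
     [rev_task path q info]       reverses [path] and starts a search;
     [search_task q info]         makes the top true if [q] splits into paths to
                                  true leaves of the two tables in [info];
     [lits_task e acc]            makes the top false if the entry [e] occurs in
                                  an assignment of [acc];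
     [eq_task l]                  makes the top false if the pairs in [l] consist
                                  of equal trees;
     [final_task l]               replaces the top by its value at the path of
                                  ones of length [size l]. *)
Definition eval_task (phi : tree) : tree := task 0 phi.
Definition comb_task (tag : tree) : tree := task 1 tag.
Definition gen_task (l acc path info : tree) : tree :=
  task 2 (Node l (Node acc (Node path info))).
Definition node_task : tree := task 3 Leaf.
Definition rev_task (path q info : tree) : tree :=
  task 4 (Node path (Node q info)).
Definition search_task (q info : tree) : tree := task 5 (Node q info).
Definition lits_task (e acc : tree) : tree := task 6 (Node e acc).
Definition eq_task (l : tree) : tree := task 7 l.
Definition final_task (l : tree) : tree := task 8 l.

Definition gen_expr (l acc path info : expr) : expr :=
  etask 2 (ECons l (ECons acc (ECons path info))).

(** Formula tags are unary, so four tails leave a node exactly for tags 5 and 6, the compound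
    formulas; five tails single out disjunction in [search_prog]. *)
Definition eval_prog : prog :=
  let tag := EHd earg in
  Branch (ETl (ETl (ETl (ETl tag))))
    (goto (ECons (etask 0 (EHd (ETl earg)))
             (ECons (etask 0 (ETl (ETl earg))) (ECons (etask 1 tag) erest))) eV)
    (goto (ECons (gen_expr eW ENil ENil earg) erest) eV).

Definition comb_prog : prog :=
  goto (ECons (gen_expr eW ENil ENil
                 (ECons earg (ECons (EHd (ETl eV)) (EHd eV)))) erest)
       (ETl (ETl eV)).

(** Once the team is exhausted, the tag in [info] selects how the entry is found. Tags 0 to 4 belong
    to formulas without subformulas; the default serves 5 and 6, where [info] holds two tables in
    place of the subformulas. A positive literal searches for the forbidden value false ([ENil]), a
    negative one for true. *)
Definition gen_prog : prog :=
  let l := EHd earg in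
  let acc := EHd (ETl earg) in
  let path := EHd (ETl (ETl earg)) in
  let info := ETl (ETl (ETl earg)) in
  let lits e := goto (ECons (etask 6 (ECons (ECons (ETl info) e) acc)) erest)
                     (ECons etrue eV) in
  Branch l
    (goto (ECons (gen_expr (ETl l) acc (ECons ENil path) info)
          (ECons (gen_expr (ETl l) (ECons (EHd l) acc) (ECons etrue path) info)
          (ECons (etask 3 ENil) erest))) eV)
    (switch (EHd info)
       [:: goto erest (ECons etrue eV);
           Branch acc (goto erest (ECons ENil eV)) (goto erest (ECons etrue eV));
           lits ENil;
           lits etrue;
           Call (ECons acc (ETl info))]
       (goto (ECons (etask 4 (ECons path (ECons ENil info))) erest)
             (ECons ENil eV))).

Definition node_prog : prog :=
  goto erest (ECons (ECons (EHd (ETl eV)) (EHd eV)) (ETl (ETl eV))).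

Definition rev_prog : prog :=
  let path := EHd earg in
  let q := EHd (ETl earg) in
  let info := ETl (ETl earg) in
  Branch path
    (goto (ECons (etask 4 (ECons (ETl path) (ECons (ECons (EHd path) q) info)))
             erest) eV)
    (goto (ECons (etask 5 (ECons q info)) erest) eV).

Definition search_prog (m : semantics) : prog :=
  let q := EHd earg in
  let tag := EHd (ETl earg) in
  let A := EHd (ETl (ETl earg)) in
  let B := ETl (ETl (ETl earg)) in
  let go A' B' K := ECons (etask 5 (ECons (ETl q) (ECons tag (ECons A' B')))) K in
  Branch q
    (Branch (EHd q)
       (Branch (ETl (ETl (ETl (ETl (ETl tag)))))
          (goto (go (ETl A) (EHd B) (go (EHd A) (ETl B)
             (if m is Lax then go (ETl A) (ETl B) erest else erest))) eV)
          (goto (go (ETl A) (ETl B) erest) eV))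
       (goto (go (EHd A) (EHd B) erest) eV))
    (Branch A (Branch B (goto erest (ECons etrue (ETl eV))) (goto erest eV))
       (goto erest eV)).

Definition lits_prog : prog :=
  let e := EHd earg in
  let acc := ETl earg in
  let t := EHd acc in
  Branch acc
    (Branch t
       (goto (ECons (etask 7 (ECons (ECons e (EHd t)) ENil))
             (ECons (etask 6 (ECons e (ECons (ETl t) (ETl acc)))) erest)) eV)
       (goto (ECons (etask 6 (ECons e (ETl acc))) erest) eV))
    (goto erest eV).

Definition eq_prog : prog :=
  let a := EHd (EHd earg) in
  let b := ETl (EHd earg) in
  let l := ETl earg in
  Branch earg
    (Branch a
       (Branch b
          (goto (ECons (etask 7 (ECons (ECons (EHd a) (EHd b))
                                (ECons (ECons (ETl a) (ETl b)) l))) erest) eV)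
          (goto erest eV))
       (Branch b (goto erest eV) (goto (ECons (etask 7 l) erest) eV)))
    (goto erest (ECons ENil (ETl eV))).

Definition final_prog : prog :=
  Branch earg
    (goto (ECons (etask 8 (ETl earg)) erest) (ECons (ETl (EHd eV)) (ETl eV)))
    (goto erest eV).

Definition machine (m : semantics) : prog :=
  switch (EHd etop)
    [:: eval_prog; comb_prog; gen_prog; node_prog; rev_prog; search_prog m;
        lits_prog; eq_prog] final_prog.

(** * Table lookup and the search for a split, specified on bit lists *)

Fixpoint tree_eqb (u v : tree) : bool :=
  match u, v with
  | Leaf, Leaf => true
  | Node u1 u2, Node v1 v2 => tree_eqb u1 v1 && tree_eqb u2 v2
  | _, _ => false
  end.

Lemma tree_eqP : Equality.axiom tree_eqb.
Proof.
elim=> [|u1 IH1 u2 IH2] [|v1 v2] /=; try by constructor.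
by apply: (iffP andP) => [[/IH1-> /IH2->]|[/IH1-> /IH2->]].
Qed.

HB.instance Definition _ := hasDecEq.Build tree tree_eqP.

Definition child (t : tree) (x : bool) : tree := if x then ttl t else thd t.

Definition lookup (tbl : tree) (bs : seq bool) : tree := foldl child tbl bs.

(* [bit_split m disj x y z]: membership [z] in a team may be split into
   memberships [x] and [y] in the subteams for the two subformulas of a
   disjunction ([disj]) or a conjunction. *)
Definition bit_split (m : semantics) (disj x y z : bool) : bool :=
  if disj then (x || y == z) && (if m is Strict then ~~ (x && y) else true)
  else (x == z) && (y == z).

Lemma bit_split_false m disj x y :
  bit_split m disj x y false = ~~ x && ~~ y.
Proof. by case: m disj x y => [] [] [] []. Qed.

Fixpoint path_split m disj (bs b1 b2 : seq bool) : bool :=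
  match bs, b1, b2 with
  | [::], [::], [::] => true
  | z :: bs', x :: b1', y :: b2' => bit_split m disj x y z && path_split m disj bs' b1' b2'
  | _, _, _ => false
  end.

Fixpoint found m disj (bs : seq bool) (A B : tree) : bool :=
  if bs is z :: bs' then
    has (fun x => has (fun y => bit_split m disj x y z &&
                                found m disj bs' (child A x) (child B y))
                      [:: true; false]) [:: true; false]
  else (A != Leaf) && (B != Leaf).

Lemma found_cons m disj z bs A B : found m disj (z :: bs) A B =
  has (fun x => has (fun y => bit_split m disj x y z &&
                              found m disj bs (child A x) (child B y))
                    [:: true; false]) [:: true; false].
Proof. by []. Qed.

Lemma foundP m disj bs A B :
  reflect (exists b1 b2, [/\ path_split m disj bs b1 b2, lookup A b1 != Leaf &
                             lookup B b2 != Leaf])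
          (found m disj bs A B).
Proof.
elim: bs A B => [|z bs IH] A B.
  apply: (iffP andP) => [[hA hB]|]; first by exists [::], [::].
  by move=> [[|? ?] [[|? ?] []]].
rewrite found_cons; apply: (iffP hasP) => [[x _ /hasP[y _ /andP[xy /IH[b1 [b2 [h hA hB]]]]]]|].
  by exists (x :: b1), (y :: b2); split; rewrite //= xy.
move=> [[|x b1] [[|y b2] []]] // /andP[xy h] hA hB.
exists x; first by case: (x).
apply/hasP; exists y; first by case: (y).
by rewrite xy; apply/IH; exists b1, b2.
Qed.

Lemma path_split_size m disj bs b1 b2 : path_split m disj bs b1 b2 ->
  size b1 = size bs /\ size b2 = size bs.
Proof.
elim: bs b1 b2 => [|z bs IH] [|x b1] [|y b2] //= /andP[_ /IH[-> ->]].
by [].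
Qed.

(** * Effect and step count of the single tasks *)

Section MachineRuns.

Variables (c : cmd) (b : nat) (m : semantics).

Local Notation run := (reach c b (machine m)).
Local Notation codes := (code_seq id).
Local Notation bits := (code_seq code_bool).

Ltac advance := apply: reach_ret; [by [] | reflexivity | rewrite /=].

(** The left components alone give the measure: splitting a pair of nodes lowers their total size by
    one, consuming a pair of leaves as well, and a mismatch discards the remaining worklist. *)
Lemma run_eq (l : seq (tree * tree)) K r V W :
  run (sumn [seq tsize p.1 | p <- l]).+1
    (state (Node (eq_task (code_seq (fun p => Node p.1 p.2) l)) K) (Node r V) W)
    (state K (Node (if all (fun p => p.1 == p.2) l then Leaf else r) V) W).
Proof.
have [n] := ubnP (sumn [seq tsize p.1 | p <- l]).
elim: n l => // n IH [|[u v] l] /= le_n.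
  by advance; apply: ReachRefl.
case: u le_n => [|u1 u2]; case: v => [|v1 v2] /= le_n.
- advance; rewrite add1n; apply: IH; lia.
- by advance; apply: ReachRefl.
- by advance; apply: ReachRefl.
advance; have := IH [:: (u1, v1), (u2, v2) & l].
rewrite /= andbA addnA; apply; lia.
Qed.

(** Each comparison can only turn the top into [Leaf], so the outcomes accumulate. An entry costs
    one step plus at most [tsize e + 1] for the comparison. *)
Lemma run_lits e (ll : seq (seq tree)) K r V W :
  run ((size ll + sumn [seq size t | t <- ll]) * (tsize e + 2)).+1
    (state (Node (lits_task e (code_seq codes ll)) K) (Node r V) W)
    (state K (Node (if has (fun t => e \in t) ll then Leaf else r) V) W).
Proof.
elim: ll r => [|t ll IH] r /=; first by advance; apply: ReachRefl.
elim: t r => [|y t IHt] r /=.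
  advance; rewrite add0n; apply: reach_leq (IH r); nia.
advance.
have E1 := run_eq [:: (e, y)]
  (Node (lits_task e (code_seq codes (t :: ll))) K) r V W.
have E2 := IHt (if e == y then Leaf else r).
have -> : (if (e \in y :: t) || has (fun t0 => e \in t0) ll then Leaf else r) =
          if (e \in t) || has (fun t0 => e \in t0) ll then Leaf
          else if e == y then Leaf else r.
  by rewrite in_cons; case: (e == y) => //; rewrite if_same.
rewrite /= andbT in E1; apply: reach_leq (reach_trans E1 E2).
rewrite /=; nia.
Qed.

Definition comp_tag (disj : bool) : tree := code_nat (if disj then 6 else 5).

(** Searches only ever turn the top to true, so successive branches leave the disjunction of their
    outcomes, whatever their order. A set bit opens at most three branches, and 3 * 4^k + 1 <=
    4^(k+1). *)
Lemma run_search disj (bs : seq bool) A B K r V W :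
  run (4 ^ size bs)
    (state (Node (search_task (bits bs) (Node (comp_tag disj) (Node A B))) K)
       (Node r V) W)
    (state K (Node (if found m disj bs A B then Node Leaf Leaf else r) V) W).
Proof.
elim: bs A B K r => [|z bs IH] A B K r /=.
  by case: A => [|A0 A1]; [|case: B => [|B0 B1]]; advance; apply: ReachRefl.
have pos : 0 < 4 ^ size bs by rewrite expn_gt0.
rewrite expnS; case: z => /=; last first.
  apply: reach_leq (_ : (4 ^ size bs).+1 <= _) _; first lia.
  advance; move: {IH}(IH (thd A) (thd B) K r).
  by rewrite !bit_split_false /= !orbF.
case: disj IH => IH; last first.
  apply: reach_leq (_ : (4 ^ size bs).+1 <= _) _; first lia.
  by advance; have := IH (ttl A) (ttl B) K r; rewrite /= !orbF.
case: m IH => IH.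
  apply: reach_leq (_ : (4 ^ size bs + (4 ^ size bs + 4 ^ size bs)).+1 <= _) _.
    lia.
  advance; apply: reach_trans (IH _ _ _ _) _.
  apply: reach_trans (IH _ _ _ _) _.
  have := IH (ttl A) (ttl B) K; rewrite /bit_split /=.
  move=> H; set f1 := found _ _ _ _ _; set f2 := found _ _ _ _ _.
  have := H (if f2 then Node Leaf Leaf else if f1 then Node Leaf Leaf else r).
  set f3 := found _ _ _ _ _.
  by case: f1; case: f2; case: f3.
apply: reach_leq (_ : (4 ^ size bs + 4 ^ size bs).+1 <= _) _.
  lia.
advance; apply: reach_trans (IH _ _ _ _) _.
have := IH (thd A) (ttl B) K; rewrite /bit_split /=.
move=> H; set f1 := found _ _ _ _ _.
have := H (if f1 then Node Leaf Leaf else r).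
set f2 := found _ _ _ _ _.
by case: f1; case: f2.
Qed.

Lemma run_rev (p q : seq bool) info K V W :
  run (size p).+1
    (state (Node (rev_task (bits p) (bits q) info) K) V W)
    (state (Node (search_task (bits (catrev p q)) info) K) V W).
Proof.
elim: p q => [|x p IH] q /=; first by advance; apply: ReachRefl.
advance; exact: (IH (x :: q)).
Qed.

Lemma run_final (l : seq tree) K v V W :
  run (size l).+1
    (state (Node (final_task (codes l)) K) (Node v V) W)
    (state K (Node (lookup v (nseq (size l) true)) V) W).
Proof.
elim: l v => [|x l IH] v /=; first by advance; apply: ReachRefl.
by advance; apply: IH.
Qed.

(** One step expands an inner node and one joins its subtables, so T(k+1) = 2 T(k) + 2 with T(0) =
    n, which gives the bound. Keeping [P] abstract lets the same traversal serve every kind of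
    formula. *)
Lemma run_gen (n : nat) (info W : tree) (wl : seq tree) (P : seq bool -> Prop) :
  (forall bs K V, size bs = size wl -> exists2 v,
     run n (state (Node (gen_task Leaf (codes (rev (mask bs wl)))
                          (bits (rev bs)) info) K) V W)
           (state K (Node v V) W)
     & v <> Leaf <-> P bs) ->
  forall l2 l1 bs1 K V, wl = l1 ++ l2 -> size bs1 = size l1 -> exists2 tbl,
     run (2 ^ size l2 * n.+2 - 2)
       (state (Node (gen_task (codes l2) (codes (rev (mask bs1 l1)))
                          (bits (rev bs1)) info) K) V W)
       (state K (Node tbl V) W)
     & forall bs2, size bs2 = size l2 -> lookup tbl bs2 <> Leaf <-> P (bs1 ++ bs2).
Proof.
move=> leaf; elim=> [|x l2 IH] l1 bs1 K V wlE szE.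
  rewrite cats0 in wlE; rewrite -wlE in szE *.
  have [v R vP] := leaf bs1 K V szE.
  exists v; first by apply: reach_leq R; rewrite mul1n; lia.
  by move=> bs2 /size0nil ->; rewrite cats0.
have szR y : size (rcons bs1 y) = size (rcons l1 x) by rewrite !size_rcons szE.
have wlR : wl = rcons l1 x ++ l2 by rewrite cat_rcons.
(* The false choice runs first while the true one waits on the task stack, so its table [A] ends up
   below [B], as [node_prog] expects. *)
pose K1 y := if y then Node node_task K else Node (gen_task (codes l2)
   (codes (rev (mask (rcons bs1 true) (rcons l1 x))))
   (bits (rev (rcons bs1 true))) info) (Node node_task K).
have [A RA AP] := IH _ (rcons bs1 false) (K1 false) V wlR (szR false).
have [B RB BP] := IH _ (rcons bs1 true) (K1 true) (Node A V) wlR (szR true).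
exists (Node A B).
  have := leq_pexp2l (isT : 0 < 2) (leq0n (size l2)) => /= pos.
  apply: reach_leq (_ : (2 ^ size l2 * n.+2 - 2 + (2 ^ size l2 * n.+2 - 2 + 1)).+1
                        <= _) _.
    by rewrite expnS; nia.
  move: RA RB; rewrite /K1 !mask_rcons // !cats0 cats1 !rev_rcons /= => RA RB.
  advance; apply: reach_trans RA _; apply: reach_trans RB _.
  by advance; apply: ReachRefl.
move=> [|y bs2] //= [sz2].
by rewrite -cat_rcons; case: y; [exact: BP | exact: AP].
Qed.

End MachineRuns.

(** * Subteams as bit masks *)

Definition subteam (l : seq assignment) (bs : seq bool) : team :=
  [fset a in mask bs l]%fset.

Lemma in_subteam (l : seq assignment) bs a : uniq l ->
  (a \in subteam l bs) = (a \in l) && nth false bs (index a l).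
Proof. by move=> Ul; rewrite in_fset /= in_mask. Qed.

Lemma subteam_mem (l : seq assignment) (T : team) :
  (forall a, a \in T -> a \in l) -> subteam l [seq a \in T | a <- l] = T.
Proof.
move=> Tl; rewrite /subteam -filter_mask; apply/fsetP => a.
rewrite in_fset /= mem_filter.
by case aT: (a \in T) => //=; rewrite Tl.
Qed.

Lemma path_splitP m disj bs b1 b2 :
  size b1 = size bs -> size b2 = size bs ->
  reflect (forall i, i < size bs ->
             bit_split m disj (nth false b1 i) (nth false b2 i) (nth false bs i))
          (path_split m disj bs b1 b2).
Proof.
elim: bs b1 b2 => [|z bs IH] [|x b1] [|y b2] //=; first by constructor.
move=> [s1] [s2]; apply: (iffP andP) => [[xyz /IH H] [|i] //|H].
  exact: H.
by split; [exact: (H 0) | apply/IH => // i ilt; exact: (H i.+1)].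
Qed.

Lemma path_split_conj m bs b1 b2 :
  path_split m false bs b1 b2 <-> b1 = bs /\ b2 = bs.
Proof.
split.
  by elim: bs b1 b2 => [|z bs IH] [|x b1] [|y b2] //=
     /andP[/andP[/eqP-> /eqP->] /IH[-> ->]].
by move=> [-> ->]; elim: bs => //= z bs ->; rewrite /bit_split !eqxx.
Qed.

(** Since [l] has no repetitions, positions correspond to assignments, and the set equations can be
    read off bit by bit. *)
Lemma path_split_disj m (l : seq assignment) bs b1 b2 : uniq l ->
  size bs = size l -> size b1 = size l -> size b2 = size l ->
  path_split m true bs b1 b2 <->
  (subteam l b1 `|` subteam l b2 = subteam l bs /\
   (m = Strict -> subteam l b1 `&` subteam l b2 = fset0))%fset.
Proof.
move=> Ul s0 s1 s2; split.
  move/path_splitP; rewrite s0 => /(_ s1 s2) H; split.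
    apply/fsetP => a; rewrite in_fsetU !in_subteam //.
    by case al: (a \in l) => //=; move: (H (index a l));
       rewrite index_mem al => /(_ isT)/andP[/eqP].
  move=> mS; apply/fsetP => a; rewrite in_fsetI in_fset0 !in_subteam //.
  case al: (a \in l) => //=; move: (H (index a l)).
  by rewrite index_mem al mS => /(_ isT)/andP[_ /negbTE].
move=> [/fsetP HU HI]; apply/path_splitP; rewrite ?s0 // => i il.
have /(_ i il) [a al ai] : forall i, i < size l -> exists2 a, a \in l & index a l = i.
  move=> j; case: l Ul {s0 s1 s2 HU HI il} => // a0 l Ul jl.
  exists (nth a0 (a0 :: l) j); first exact: mem_nth.
  exact: index_uniq.
apply/andP; split.
  by move: (HU a); rewrite in_fsetU !in_subteam // al ai /= => ->.
case: m HI => // /(_ erefl)/fsetP/(_ a).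
by rewrite in_fsetI in_fset0 !in_subteam // al ai /= => ->.
Qed.

(** Both parts of a split lie inside the team, so each is the subteam of its own membership mask and
    nothing is lost by ranging over masks only. *)
Lemma sat_or_masks (L : logic) m (l : seq assignment) bs (phi psi : formula L) :
  uniq l -> size bs = size l ->
  sat m (subteam l bs) (FOr phi psi) <->
  exists b1 b2, [/\ path_split m true bs b1 b2, sat m (subteam l b1) phi &
                    sat m (subteam l b2) psi].
Proof.
move=> Ul s0; split => /=.
  move=> [T1 [T2 [U12 I12 H1 H2]]].
  have inl a : a \in (T1 `|` T2)%fset -> a \in l.
    by rewrite U12 in_subteam // => /andP[].
  have E1 : subteam l [seq a \in T1 | a <- l] = T1.
    by apply: subteam_mem => a aT; apply: inl; rewrite inE aT.
  have E2 : subteam l [seq a \in T2 | a <- l] = T2.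
    by apply: subteam_mem => a aT; apply: inl; rewrite inE aT orbT.
  exists [seq a \in T1 | a <- l], [seq a \in T2 | a <- l].
  rewrite E1 E2; split => //.
  by apply/(path_split_disj m Ul); rewrite ?size_map // E1 E2.
move=> [b1 [b2 [S12 H1 H2]]].
have [s1 s2] := path_split_size S12; rewrite s0 in s1 s2.
have [U I] := (path_split_disj m Ul s0 s1 s2).1 S12.
by exists (subteam l b1), (subteam l b2).
Qed.

Lemma sat_and_masks (L : logic) m (l : seq assignment) bs (phi psi : formula L) :
  sat m (subteam l bs) (FAnd phi psi) <->
  exists b1 b2, [/\ path_split m false bs b1 b2, sat m (subteam l b1) phi &
                    sat m (subteam l b2) psi].
Proof.
split => /= [[H1 H2]|[b1 [b2 [/path_split_conj[-> ->] H1 H2]]]] //.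
by exists bs, bs; split => //; apply/path_split_conj.
Qed.

(** * Codes *)

Lemma code_seq_inj (A : Type) (code : A -> tree) :
  injective code -> injective (code_seq code).
Proof.
by move=> inj; elim=> [|a l IH] [|a' l'] //= [/inj-> /IH->].
Qed.

Lemma code_bool_inj : injective code_bool.
Proof. by case=> [] []. Qed.

Lemma code_var_inj : injective code_var.
Proof. exact: code_seq_inj code_bool_inj. Qed.

Definition code_entry (xb : var * bool) : tree :=
  Node (code_var xb.1) (code_bool xb.2).

Lemma code_entry_inj : injective code_entry.
Proof. by move=> [x b] [y b'] [/code_var_inj-> /code_bool_inj->]. Qed.

Lemma code_seq_map (A : Type) (code : A -> tree) l :
  code_seq code l = code_seq id (map code l).
Proof. by elim: l => //= a l ->. Qed.

Lemma codes_assignment_fun w s s' :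
  codes_assignment w s -> codes_assignment w s' -> s = s'.
Proof.
move=> [l [_ ls wl]] [l' [_ ls' wl']].
have ll' : l = l' by apply: (code_seq_inj code_entry_inj); rewrite -wl.
subst l'; apply/fmapP => x.
case sx: (s.[? x])%fmap => [v|]; first by move/ls/ls': sx => ->.
case s'x: (s'.[? x])%fmap => [v|] //.
by move/ls'/ls: s'x; rewrite sx.
Qed.

Lemma codes_list_fun (A : Type) (codes : tree -> A -> Prop) w l l' :
  (forall w a a', codes w a -> codes w a' -> a = a') ->
  codes_list codes w l -> codes_list codes w l' -> l = l'.
Proof.
move=> F H; elim: H l' => {w l} [|w a v l wa _ IH] l' H; inversion H; subst=> //.
by congr (_ :: _); [exact: F wa _ | exact: IH].
Qed.

Lemma codes_team_fun w T T' : codes_team w T -> codes_team w T' -> T = T'.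
Proof.
move=> [l [_ lT wl]] [l' [_ lT' wl']].
have E := codes_list_fun codes_assignment_fun wl wl'; subst l'.
by apply/fsetP => a; rewrite -lT lT'.
Qed.

Lemma code_formula_inj (L : logic) : injective (@code_formula L).
Proof.
elim=> [||x|x|a|f1 IH1 f2 IH2|f1 IH1 f2 IH2] [||y|y|a'|g1 g2|g1 g2] //=.
- by case=> /code_var_inj->.
- by case=> /code_var_inj->.
- by case=> /(@atom_code_inj L)->.
- by case=> /IH1-> /IH2->.
- by case=> /IH1-> /IH2->.
Qed.

(** [is_yes] asks for some decoding of the input that is satisfied; uniqueness of the decoding makes
    this agree with the one that was evaluated. *)
Lemma mc_instance_fun (L : logic) x T T' (phi phi' : formula L) :
  mc_instance x T phi -> mc_instance x T' phi' -> T = T' /\ phi = phi'.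
Proof.
move=> [X [w [_ _ wT ->]]] [X' [w' [_ _ w'T' [ww' /code_formula_inj->]]]].
by subst w'; split => //; apply: codes_team_fun wT w'T'.
Qed.

Lemma tsize_codes (l : seq tree) :
  tsize (code_seq id l) = (sumn [seq (tsize t).+1 | t <- l]).+1.
Proof. by elim: l => //= t l ->; lia. Qed.

Lemma tsize_codes_mask bs (l : seq tree) :
  tsize (code_seq id (rev (mask bs l))) <= tsize (code_seq id l).
Proof.
rewrite !tsize_codes map_rev sumn_rev ltnS.
by elim: l bs => [|t l IH] [|[] bs] //=; have := IH bs; lia.
Qed.

Lemma size_codes (l : seq tree) : size l <= tsize (code_seq id l).
Proof. by elim: l => //= t l IH; lia. Qed.

Lemma size_nested_codes (ll : seq (seq tree)) :
  size ll + sumn [seq size t | t <- ll] <= tsize (code_seq (code_seq id) ll).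
Proof. by elim: ll => //= t ll IH; have := size_codes t; lia. Qed.

(** Pairing each code with its object lets a single mask select a subteam and its code together. *)
Lemma codes_list_pairs (A : eqType) (codes : tree -> A -> Prop) w l :
  codes_list codes w l -> exists ql : seq (tree * A),
    [/\ w = code_seq id (unzip1 ql), l = unzip2 ql &
        forall q, q \in ql -> codes q.1 q.2].
Proof.
elim=> {w l} [|w a v l wa _ [ql [-> -> H]]]; first by exists [::].
exists ((w, a) :: ql); split => // q; rewrite in_cons => /predU1P[->//|].
exact: H.
Qed.

Lemma pairs_codes_list (A : eqType) (codes : tree -> A -> Prop) (ql : seq (tree * A)) :
  (forall q, q \in ql -> codes q.1 q.2) ->
  codes_list codes (code_seq id (unzip1 ql)) (unzip2 ql).
Proof.
elim: ql => [|q ql IH] H /=; constructor; first by apply: H; rewrite mem_head.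
by apply: IH => q' q'l; apply: H; rewrite in_cons q'l orbT.
Qed.

(** * Correctness and running time *)

Lemma entries_of_pairs (r : seq (tree * assignment)) :
  (forall q, q \in r -> codes_assignment q.1 q.2) ->
  exists2 ll : seq (seq tree),
    code_seq id (unzip1 r) = code_seq (code_seq id) ll &
    forall x v, has (fun t => code_entry (x, v) \in t) ll <->
                exists2 a, a \in unzip2 r & (a.[? x])%fmap = Some v.
Proof.
elim: r => [|[w a] r IH] rP; first by exists [::] => // x v; split => // -[].
have [q qr|ll llE llP] := IH; first by apply: rP; rewrite in_cons qr orbT.
have [l [_ lP /= wE]] := rP _ (mem_head _ _).
exists (map code_entry l :: ll) => [|x v].
  by rewrite /= llE wE -code_seq_map.
rewrite /= mem_map; last exact: code_entry_inj.
split.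
  case/orP => [/lP ax|/llP[a' a'r a'x]]; first by exists a; rewrite ?mem_head.
  by exists a' => //; rewrite in_cons a'r orbT.
move=> [a']; rewrite in_cons => /predU1P[-> /lP->//|a'r a'x].
by apply/orP; right; apply/llP; exists a'.
Qed.

Section Evaluation.

Variables (L : logic) (m : semantics) (c : cmd) (p : {poly nat}).
Hypothesis cP : forall (X : {fset var}) (T : team) (a : atom L) (w : tree),
  team_over X T -> (atom_vars a `<=` X)%fset -> codes_team w T ->
  decides_within c (Node w (atom_code a)) (atom_sat T a)
    (horner p (tsize w + tsize (atom_code a))).

Variables (X : {fset var}) (ql : seq (tree * assignment)) (n : nat).
Hypothesis Uq : uniq (unzip2 ql).
Hypothesis qP : forall q, q \in ql -> codes_assignment q.1 q.2.
Hypothesis qX : forall a, a \in unzip2 ql -> domf a = X.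

Local Notation W := (code_seq id (unzip1 ql)).
Local Notation sub := (subteam (unzip2 ql)).
Local Notation run := (reach c (horner p n) (machine m)).
Local Notation accum bs := (code_seq id (rev (mask bs (unzip1 ql)))).

(** Covers every way of filling an entry: [n * n] for scanning the literals, [n] for reversing a
    path and the power of 4 for a search. *)
Definition leaf_steps : nat := n * n + n + 4 ^ size ql + 3.
Definition table_steps : nat := 2 ^ size ql * leaf_steps.+2.

Ltac advance := apply: reach_ret; [by [] | reflexivity | rewrite /=].

Lemma accum_pairs bs :
  accum bs = code_seq id (unzip1 (rev (mask bs ql))) /\
  rev (mask bs (unzip2 ql)) = unzip2 (rev (mask bs ql)).
Proof. by rewrite /unzip1 /unzip2 !map_rev !map_mask. Qed.

Lemma codes_team_accum bs : codes_team (accum bs) (sub bs).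
Proof.
exists (rev (mask bs (unzip2 ql))); split.
- by rewrite rev_uniq mask_uniq.
- by move=> a; rewrite mem_rev in_fset.
have [-> ->] := accum_pairs bs; apply: pairs_codes_list => q.
by rewrite mem_rev => /mem_mask /qP.
Qed.

Lemma team_over_sub bs : team_over X (sub bs).
Proof. by move=> a; rewrite in_subteam // => /andP[/qX]. Qed.

Lemma sub_empty bs : accum bs = Leaf <-> sub bs = fset0.
Proof.
have E : (sub bs =i rev (mask bs (unzip2 ql))).
  by move=> a; rewrite mem_rev in_fset.
have [wE lE] := accum_pairs bs; rewrite wE; rewrite lE in E.
case: (rev _) E => [|q r] E.
  by split => // _; apply/fsetP => a; rewrite E.
by split => // E0; have := E q.2; rewrite E0 in_fset0 mem_head.
Qed.

(** All members have domain [X], so [x] always has a value, and the literal holds iff no member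
    contains the opposite entry. The 6 is the overhead of the code of [FPos x]; it guarantees
    [tsize e + 2 <= n] for the entry [e] sought. *)
Lemma run_lits_leaf bs x v K V :
  x \in X -> tsize (code_var x) + 6 <= n -> tsize W <= n ->
  exists2 r,
    run leaf_steps.-1
      (state (Node (lits_task (code_entry (x, ~~ v)) (accum bs)) K)
         (Node (Node Leaf Leaf) V) W)
      (state K (Node r V) W) &
    r <> Leaf <-> forall a, a \in sub bs -> (a.[? x])%fmap = Some v.
Proof.
move=> xX szx szW; have [wE lE] := accum_pairs bs.
have [q|ll llE llP] := @entries_of_pairs (rev (mask bs ql)).
  by rewrite mem_rev => /mem_mask /qP.
move: (size_nested_codes ll); rewrite -llE -wE => szll.
exists (if has (fun t => code_entry (x, ~~ v) \in t) ll then Leaf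
        else Node Leaf Leaf).
  rewrite wE llE; apply: reach_leq (run_lits _ _ _ _ _ _ _ _ _).
  have := leq_trans (tsize_codes_mask bs (unzip1 ql)) szW.
  have : tsize (code_entry (x, ~~ v)) + 2 <= n by case: (v) => /=; lia.
  rewrite /leaf_steps; set e := tsize (code_entry _); set u := tsize _ in szll *.
  set a := _ + sumn _ in szll *; move: (4 ^ _) => q; clearbody e u a; nia.
case: ifP => [/llP[a]|/negP H].
  rewrite -lE mem_rev => al ax; split => // /(_ a).
  by rewrite in_fset ax => /(_ al); case: (v).
split => // _ a asub; have := team_over_sub asub => aX.
move: xX; rewrite -aX => xa; rewrite (in_fnd xa); congr Some.
case: (eqVneq (a.[xa])%fmap v) => // av; case: H; apply/llP; exists a.
  by rewrite -lE mem_rev; move: asub; rewrite in_fset.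
by rewrite (in_fnd xa); congr Some; case: (a.[xa])%fmap v av => [] [].
Qed.

Lemma run_table info (P : seq bool -> Prop) K V :
  (forall bs K V, size bs = size ql -> exists2 v,
     run leaf_steps
       (state (Node (gen_task Leaf (accum bs) (code_seq code_bool (rev bs)) info) K)
          V W) (state K (Node v V) W)
     & v <> Leaf <-> P bs) ->
  exists2 tbl,
    run (table_steps - 2) (state (Node (gen_task W Leaf Leaf info) K) V W)
      (state K (Node tbl V) W)
    & forall bs, size bs = size ql -> lookup tbl bs <> Leaf <-> P bs.
Proof.
move=> leaf; have [|tbl R tblP] := @run_gen c (horner p n) m leaf_steps info W
    (unzip1 ql) P _ (unzip1 ql) [::] [::] K V erefl erefl.
  by move=> bs K' V'; rewrite size_map; apply: leaf.
by exists tbl; move: R tblP; rewrite size_map.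
Qed.

Lemma run_compound disj tA tB (P Q R : seq bool -> Prop) bs K V :
  tsize W <= n ->
  size bs = size ql ->
  (forall bs, size bs = size ql -> lookup tA bs <> Leaf <-> P bs) ->
  (forall bs, size bs = size ql -> lookup tB bs <> Leaf <-> Q bs) ->
  (R bs <-> exists b1 b2, [/\ path_split m disj bs b1 b2, P b1 & Q b2]) ->
  exists2 v,
    run leaf_steps
       (state (Node (gen_task Leaf (accum bs) (code_seq code_bool (rev bs))
                 (Node (comp_tag disj) (Node tA tB))) K) V W)
       (state K (Node v V) W)
     & v <> Leaf <-> R bs.
Proof.
move=> szW sz AP BP RE.
exists (if found m disj bs tA tB then Node Leaf Leaf else Leaf).
  apply: (@reach_leq _ _ _ ((size bs).+1 + 4 ^ size bs).+1).
    have := leq_trans (size_codes _) szW; rewrite size_map /leaf_steps sz.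
    move: (4 ^ _); nia.
  have R1 := run_rev c (horner p n) m (rev bs) [::]
    (Node (comp_tag disj) (Node tA tB)) K (Node Leaf V) W.
  (* The path was accumulated in reverse, so reversing it yields [bs] itself. *)
  rewrite -/(rev (rev bs)) revK size_rev in R1.
  have R2 := reach_trans R1 (run_search _ _ _ _ _ _ _ _ _ _ _).
  by case: disj R2 {R1 RE} => R2; advance; exact: R2.
apply: (iff_trans _ (iff_sym RE)).
case: foundP => [[b1 [b2 [S12 hA hB]]]|H].
  split => // _; have [s1 s2] := path_split_size S12; rewrite sz in s1 s2.
  by exists b1, b2; split => //; [apply/AP | apply/BP] => //; apply/eqP.
split => // -[b1 [b2 [S12 /AP hA /BP hB]]]; case: H.
have [s1 s2] := path_split_size S12; rewrite sz in s1 s2.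
by exists b1, b2; split => //; apply/eqP; [exact: hA | exact: hB].
Qed.

Lemma table_steps_ge2 : 2 <= table_steps.
Proof. by have : 0 < 2 ^ size ql by [rewrite expn_gt0]; rewrite /table_steps; nia. Qed.

Lemma run_eval (phi : formula L) K V :
  (formula_vars phi `<=` X)%fset -> tsize W + tsize (code_formula phi) <= n ->
  exists2 tbl,
    run (tsize (code_formula phi) * table_steps)
      (state (Node (eval_task (code_formula phi)) K) V W)
      (state K (Node tbl V) W)
    & forall bs, size bs = size ql -> lookup tbl bs <> Leaf <-> sat m (sub bs) phi.
Proof.
have D2 := table_steps_ge2.
have simple (f : formula L) K0 V0 :
    reach c (horner p n) (machine m) 1
      (state (Node (eval_task (code_formula f)) K0) V0 W)
      (state (Node (gen_task W Leaf Leaf (code_formula f)) K0) V0 W) ->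
    (forall bs K V, size bs = size ql -> exists2 v,
       run leaf_steps
         (state (Node (gen_task Leaf (accum bs) (code_seq code_bool (rev bs))
            (code_formula f)) K) V W) (state K (Node v V) W)
       & v <> Leaf <-> sat m (sub bs) f) ->
    exists2 tbl,
      run (tsize (code_formula f) * table_steps)
        (state (Node (eval_task (code_formula f)) K0) V0 W)
        (state K0 (Node tbl V0) W)
      & forall bs, size bs = size ql -> lookup tbl bs <> Leaf <-> sat m (sub bs) f.
  move=> R1 leaf; have [tbl R2 tblP] := run_table K0 V0 leaf; exists tbl => //.
  apply: reach_leq (reach_trans R1 R2).
  have : 0 < tsize (code_formula f) by case: (code_formula f).
  by move: D2; set D := table_steps; clearbody D; nia.
have compound disj (f1 f2 f : formula L) K0 V0 :
    code_formula f = Node (comp_tag disj) (Node (code_formula f1) (code_formula f2)) ->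
    tsize W <= n ->
    (forall K V, exists2 tbl, run (tsize (code_formula f1) * table_steps)
      (state (Node (eval_task (code_formula f1)) K) V W)
      (state K (Node tbl V) W)
      & forall bs, size bs = size ql -> lookup tbl bs <> Leaf <-> sat m (sub bs) f1) ->
    (forall K V, exists2 tbl, run (tsize (code_formula f2) * table_steps)
      (state (Node (eval_task (code_formula f2)) K) V W)
      (state K (Node tbl V) W)
      & forall bs, size bs = size ql -> lookup tbl bs <> Leaf <-> sat m (sub bs) f2) ->
    (forall bs, size bs = size ql -> sat m (sub bs) f <->
       exists b1 b2, [/\ path_split m disj bs b1 b2, sat m (sub b1) f1 &
                         sat m (sub b2) f2]) ->
    exists2 tbl,
      run (tsize (code_formula f) * table_steps)
        (state (Node (eval_task (code_formula f)) K0) V0 W)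
        (state K0 (Node tbl V0) W)
      & forall bs, size bs = size ql -> lookup tbl bs <> Leaf <-> sat m (sub bs) f.
  move=> fE szW IH1 IH2 fP.
  have [tA RA AP] := IH1 (Node (eval_task (code_formula f2))
                           (Node (comb_task (comp_tag disj)) K0)) V0.
  have [tB RB BP] := IH2 (Node (comb_task (comp_tag disj)) K0) (Node tA V0).
  have [|tbl R tblP] := @run_table (Node (comp_tag disj) (Node tA tB))
    (fun bs => sat m (sub bs) f) K0 V0.
    move=> bs K1 V1 sz.
    exact: (@run_compound disj tA tB (fun bs => sat m (sub bs) f1)
      (fun bs => sat m (sub bs) f2) (fun bs => sat m (sub bs) f) bs K1 V1
      szW sz AP BP (fP bs sz)).
  exists tbl => //.
  (* The two steps saved in [table_steps - 2] pay for the [eval_task] and the [comb_task], so this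
     formula adds just one [table_steps] to those of its subformulas. *)
  apply: (@reach_leq _ _ _ (tsize (code_formula f1) * table_steps +
    (tsize (code_formula f2) * table_steps + (table_steps - 2).+1)).+1).
    by rewrite fE /=; move: D2; set D := table_steps; clearbody D; nia.
  rewrite fE; case: disj {fE fP} RA RB R => RA RB R; advance;
    by apply: reach_trans RA _; apply: reach_trans RB _; advance; exact: R.
elim: phi K V => [||x|x|a|f1 IH1 f2 IH2|f1 IH1 f2 IH2] K V fX szn.
- apply: simple => [|bs K1 V1 sz]; first by advance; apply: ReachRefl.
  exists (Node Leaf Leaf); last by split.
  by rewrite /leaf_steps addnS; advance; apply: ReachRefl.
- apply: simple => [|bs K1 V1 sz]; first by advance; apply: ReachRefl.
  have H := sub_empty bs; rewrite /leaf_steps addnS.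
  case: (accum bs) H => [|u v] H.
    exists (Node Leaf Leaf); first by advance; apply: ReachRefl.
    by split => // _; apply/H.
  exists Leaf; first by advance; apply: ReachRefl.
  by split => // /H.
- apply: simple => [|bs K1 V1 sz]; first by advance; apply: ReachRefl.
  have [|||r R rP] := @run_lits_leaf bs x true K1 V1.
  + by move: fX; rewrite /= fsub1set.
  + by move: szn => /=; rewrite /code_var; lia.
  + by lia.
  exists r => //; apply: (@reach_leq _ _ _ (leaf_steps.-1).+1).
    by rewrite /leaf_steps; lia.
  by advance; exact: R.
- apply: simple => [|bs K1 V1 sz]; first by advance; apply: ReachRefl.
  have [|||r R rP] := @run_lits_leaf bs x false K1 V1.
  + by move: fX; rewrite /= fsub1set.
  + by move: szn => /=; rewrite /code_var; lia.
  + by lia.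
  exists r => //; apply: (@reach_leq _ _ _ (leaf_steps.-1).+1).
    by rewrite /leaf_steps; lia.
  by advance; exact: R.
- apply: simple => [|bs K1 V1 sz]; first by advance; apply: ReachRefl.
  have [s [t [E le_t sP]]] := cP (@team_over_sub bs) fX (codes_team_accum bs).
  exists (s 0) => //; rewrite /leaf_steps addnS.
  apply: (@reach_call _ _ _ _ _ (Node (accum bs) (atom_code a)) (s 0)) => //.
    exists s, t; split => //; apply: leq_trans le_t _; apply: horner_nat_mono.
    apply: leq_trans szn; rewrite /=.
    by have := tsize_codes_mask bs (unzip1 ql); lia.
  exact: ReachRefl.
- have [fX1 fX2] : (formula_vars f1 `<=` X)%fset /\ (formula_vars f2 `<=` X)%fset.
    by apply/andP; rewrite -fsubUset.
  rewrite /= in szn; apply: (compound false f1 f2) => // [|K1 V1|K1 V1|bs sz].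
  + by lia.
  + by apply: IH1 => //; lia.
  + by apply: IH2 => //; lia.
  + exact: sat_and_masks.
- have [fX1 fX2] : (formula_vars f1 `<=` X)%fset /\ (formula_vars f2 `<=` X)%fset.
    by apply/andP; rewrite -fsubUset.
  rewrite /= in szn; apply: (compound true f1 f2) => // [|K1 V1|K1 V1|bs sz].
  + by lia.
  + by apply: IH1 => //; lia.
  + by apply: IH2 => //; lia.
  + by apply: sat_or_masks; rewrite // size_map.
Qed.

End Evaluation.

(** The team code [w] doubles as a unary counter for [final_task]: the path of ones of that length
    is the entry of the whole team. *)
Definition prologue : expr :=
  let w := EHd (EHd (EVar 0)) in
  let phi := ETl (EHd (EVar 0)) in
  ECons (ECons (etask 0 phi) (ECons (etask 8 w) ENil)) (ECons ENil w).

Definition mc_program (m : semantics) (c : cmd) : cmd :=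
  let N := (cmd_vars c).+1 in
  Seq (Assign N prologue)
  (Seq (While (EHd (EVar N)) (compile N c (machine m)))
       (Assign 0 (EHd (EHd (ETl (EVar N)))))).

(** The first factor bounds the iterations up to the power of 8, the second the cost of one with its
    loop test; the rest pays for the prologue, the failing test (3) and the output assignment
    (5). *)
Definition mc_time (m : semantics) (c : cmd) (p : {poly nat}) (n : nat) : nat :=
  (n * (n * n + n + 6) + n + 1)
  * (step_cost (cmd_vars c).+1 (horner p n) (machine m) + 3)
  + ((ecost prologue).+1 + 3 + 5).

Lemma polynomial_mc_time m c p : polynomial_fun (mc_time m c p).
Proof.
rewrite /mc_time /step_cost.
by do ?[apply: polynomial_add | apply: polynomial_mul | exact: polynomial_id
       | exact: polynomial_horner | exact: polynomial_const].
Qed.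

(** The summand [k.+1] is the final lookup. With b = 4^k >= 1, u + b + 5 <= b (u + 6) pulls the
    power out of the cost of an entry. *)
Lemma mc_steps_le k n s : k <= n -> s <= n ->
  s * (2 ^ k * (n * n + n + 4 ^ k + 3).+2) + k.+1
    <= 8 ^ k * (n * (n * n + n + 6) + n + 1).
Proof.
move=> kn sn.
have -> : 8 ^ k = 2 ^ k * 4 ^ k by rewrite -expnMn.
have : 0 < 2 ^ k by rewrite expn_gt0.
have : 0 < 4 ^ k by rewrite expn_gt0.
move: (2 ^ k) (4 ^ k) => a b b0 a0.
set u := n * n + n.
have H1 : a * (u + b + 3).+2 <= a * b * (u + 6) by nia.
have H2 : s * (a * (u + b + 3).+2) <= n * (a * b * (u + 6)) by apply: leq_mul.
have H3 : k.+1 <= a * b * (n + 1) by have : 0 < a * b by [nia]; nia.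
apply: leq_trans (leq_add H2 H3) _; nia.
Qed.

Lemma mc_program_correct (L : logic) (m : semantics) (c : cmd) (p : {poly nat}) :
  (forall (X : {fset var}) (T : team) (a : atom L) (w : tree),
     team_over X T -> (atom_vars a `<=` X)%fset -> codes_team w T ->
     decides_within c (Node w (atom_code a)) (atom_sat T a)
       (horner p (tsize w + tsize (atom_code a)))) ->
  forall x T (phi : formula L) k0, mc_instance x T phi ->
  decides_within (mc_program m c) (Node x k0) (sat m T phi)
    (8 ^ teamsize T * mc_time m c p (tsize x)).
Proof.
move=> cP x T phi k0 [X [w [TX phiX [l [Ul lT wl]] xE]]].
have [ql [wE lE qP]] := codes_list_pairs wl.
rewrite lE in Ul lT.
have TE : T = subteam (unzip2 ql) (nseq (size ql) true).
  by apply/fsetP => a; rewrite in_fset mask_true ?size_map // lT.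
have kE : teamsize T = size ql.
  by rewrite /teamsize TE /subteam mask_true ?size_map // card_fseq undup_id ?size_map.
have qX a : a \in unzip2 ql -> domf a = X by rewrite lT; apply: TX.
set n := tsize x; set N := (cmd_vars c).+1.
have nE : n = (tsize w + tsize (code_formula phi)).+1 by rewrite /n xE.
have szn : tsize (code_seq id (unzip1 ql)) + tsize (code_formula phi) <= n.
  by rewrite -wE nE.
have [tbl R1 tblP] := run_eval m cP Ul qP qX (Node (final_task w) Leaf) Leaf phiX szn.
have R2 := run_final c (horner p n) m (unzip1 ql) Leaf tbl Leaf
  (code_seq id (unzip1 ql)).
rewrite -wE in R1 R2; have R := reach_trans R1 R2.
set s0 := init (Node x k0).
set s1 := update s0 N (eval s0 prologue).
have s1N : s1 N = state (Node (eval_task (code_formula phi))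
                          (Node (final_task w) Leaf)) Leaf w.
  by rewrite /s1 /update eqxx /= xE.
rewrite -s1N in R.
have [s2 [t [E2 le_t s2N]]] := exec_machine (isT : 0 < N) (leqnSn _) R erefl.
exists (update s2 0 (eval s2 (EHd (EHd (ETl (EVar N)))))); eexists; split.
- apply: ExecSeq; first exact: ExecAssign.
  by apply: ExecSeq E2 _; exact: ExecAssign.
- move: le_t; rewrite size_map /table_steps /leaf_steps kE.
  have kn : size ql <= n.
    by have := size_codes (unzip1 ql); rewrite size_map -wE; lia.
  have sn : tsize (code_formula phi) <= n by lia.
  have := mc_steps_le kn sn; rewrite /mc_time -/N.
  have : 0 < 8 ^ size ql by rewrite expn_gt0.
  have -> : ecost (EHd (EHd (ETl (EVar N)))) = 4 by [].
  move: (ecost prologue) (step_cost _ _ _) (8 ^ _) => c0 sc e e0.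
  set M := _ * _ + (size ql).+1; set F := n * _ + n + 1.
  clearbody M F; move=> leM le_t.
  have : M * (sc + 3) <= e * F * (sc + 3) by rewrite leq_mul2r leM orbT.
  nia.
rewrite /update /= s2N /= size_map.
by rewrite TE; apply: tblP; rewrite size_nseq.
Qed.

Lemma model_checking_in_FPT (L : logic) (m : semantics) :
  poly_checkable L -> in_FPT (model_checking L m).
Proof.
move=> [c [p cP]]; have [q qE] := polynomial_mc_time m c p.
exists (mc_program m c), (fun k => 8 ^ k), q; split; first exact: computable_pow8.
move=> x k [T [phi [inst ->]]]; rewrite qE.
have [s [t [E le_t sP]]] := mc_program_correct m cP (code_nat (teamsize T)) inst.
exists s, t; split => //; apply: (iff_trans sP); split; first by exists T, phi.
by move=> [T' [phi' [inst' _]]]; have [-> ->] := mc_instance_fun inst inst'.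
Qed.

Theorem theorem1 (L : logic) (hL : poly_checkable L) :
  in_FPT (model_checking L Lax) /\ in_FPT (model_checking L Strict).
Proof. by split; apply: model_checking_in_FPT. Qed.
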